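(* Let $y_0$ be a minimal point of $(P(0))$ and let $\mathcal L_{y_0}$ be the Lagrange process of $(P(0))$ at $y_0$. Assume that there exists $x_1\in\Omega$ with $G(x_1)\cap(-\mathrm{int}(Z_+))\neq\emptyset$. Then $$\mathcal L_{y_0}(-z)=D(V+Y_+)(0,y_0)(z)\qquad\text{for all } z\in Z,$$ where $D(V+Y_+)(0,y_0)$ is the contingent derivative of $V+Y_+$ at $(0,y_0)$.
   Context: Setting. $X,Y,Z$ are real normed spaces with topological duals $X^*,Y^*,Z^*$. $Y_+\subset Y$ and $Z_+\subset Z$ are convex cones (a cone is a nonempty set $K$ with $\alpha K\subset K$ for all real $\alpha\ge 0$) which are proper ($\{0\}\ne K$ and $K$ is not the whole space) and solid (nonempty interior); moreover $Y_+$ is pointed: $Y_+\cap(-Y_+)=\{0\}$. $\Omega\subset X$ is a nonempty convex set, $F:\Omega\rightrightarrows Y$ and $G:\Omega\rightrightarrows Z$ are set-valued maps, $F$ is $Y_+$-convex (i.e. $\{(x,y): x\in\Omega,\ y\in F(x)+Y_+\}$ is convex) and $G$ is $Z_+$-convex. Sums of sets are Minkowski sums, with $A+\emptyset=\emptyset$. For a set-valued map $H$, $\mathrm{Graph}(H)=\{(u,v): v\in H(u)\}$, $\mathrm{Dom}(H)=\{u: H(u)\ne\emptyset\}$, $H(A)=\bigcup_{a\in A}H(a)$ for $A\subset\mathrm{Dom}(H)$. The parametric problem $(P(z))$, $z\in Z$, is: Min $F(x)$ such that $x\in\Omega$, $G(x)\cap(z-Z_+)\ne\emptyset$. Put $S(z)=\{x\in\Omega: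 G(x)\cap(z-Z_+)\neq\emptyset\}$ (assumed contained in $\mathrm{Dom}(F)$, so that the next image is defined), $V(z)=F(S(z))$, $(V+Y_+)(z)=V(z)+Y_+$; these give set-valued maps $V,\,V+Y_+:Z\rightrightarrows Y$. A minimal point of $(P(0))$ is an element of $\mathrm{Min}(V(0))$, where $\mathrm{Min}(A)=\{y\in A: A\cap(y-Y_+)=\{y\}\}$. $\mathcal S_{Y_+}(y_0)$ is the set of $(z^*,y^* )\in Z^*\times Y^*$ with $\langle z^*,z'\rangle+\langle y^*,y'\rangle\le\langle y^*,y_0\rangle\le\langle z^*,z\rangle+\langle y^*,y\rangle$ for all $(z',y')\in(-Z_+)\times(y_0-Y_+)$ and all $(z,y)\in\mathrm{Graph}(V+Y_+)$. The Lagrange process of $(P(0))$ at $y_0$ is the closed convex process (set-valued map with closed convex cone graph) $\mathcal L_{y_0}:Z\rightrightarrows Y$ given by $\mathcal L_{y_0}(z)=\{y\in Y:\langle z^*,z\rangle\le\langle y^*,y\rangle\ \text{for all }(z^*,y^* )\in\mathcal S_{Y_+}(y_0)\}$. For a nonempty subset $A$ of a normed space and $u\in\mathrm{cl}(A)$, the contingent cone is $T_A(u)=\{v:\liminf_{h\to0+}d(A,u+hv)/h=0\}$, $d$ being the distance induced by the norm. For a set-valued map $H:Z\rightrightarrows Y$ and $(z_0,y_0)\in\mathrm{Graph}(H)$, the contingent derivative $DH(z_0,y_0):Z\rightrightarrows Y$ is defined by $\mathrm{Graph}(DH(z_0,y_0))=T_{\mathrm{Graph}(H)}(z_0,y_0)$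 ($Z\times Y$ with a product norm). *)

(* Defs.v *)
From HB Require Import structures.
From mathcomp Require Import all_boot all_order all_algebra.
From mathcomp Require Import all_classical all_reals all_analysis.

Set Implicit Arguments.
Unset Strict Implicit.
Unset Printing Implicit Defensive.

Import Order.TTheory GRing.Theory Num.Theory.
Import numFieldNormedType.Exports.

Local Open Scope classical_set_scope.
Local Open Scope ring_scope.

(* A set-valued map on a subset Omega of X is represented by a function
   X -> set Y all of whose uses are restricted to Omega. *)

Section Sets.
Context {V : zmodType}.
Implicit Types A B : set V.

Definition minkowski_sum A B : set V := [set a + b | a in A & b in B].

Definition set_opp A : set V := [set - a | a in A].

Definition shift_opp (v : V) A : set V := [set v - a | a in A].

End Sets.

Section SetValuedMaps.
Context {S T : Type}.
Implicit Type H : S -> set T.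

Definition sv_graph H : set (S * T) := [set p | H p.1 p.2].

Definition sv_dom H : set S := [set u | H u !=set0].

Definition sv_image H (A : set S) : set T := \bigcup_(a in A) H a.

End SetValuedMaps.

Section Cones.
Context {R : realType} {V : normedModType R}.
Implicit Type K : set V.

Definition is_cone K :=
  K !=set0 /\ forall (a : R) (x : V), 0 <= a -> K x -> K (a *: x).

Definition convex_cone K := is_cone K /\ convex_set K.

Definition proper_cone K := K <> [set 0] /\ K <> setT.

Definition solid K := K° !=set0.

Definition pointed K := K `&` set_opp K = [set 0].

Definition Min K (A : set V) : set V :=
  [set y | A y /\ A `&` shift_opp y K = [set y]].

End Cones.

Section ContingentCone.
Context {R : realType}.
Local Open Scope ereal_scope.

(* extended-real valued: equal to +oo when A is empty *)
Definition dist_set {E : normedModType R} (A : set E) (u : E) : \bar R :=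
  ereal_inf [set (`|u - a|%R)%:E | a in A].

(* meant for A nonempty and u in the closure of A *)
Definition contingent_cone {E : normedModType R} (A : set E) (u : E) : set E :=
  [set v | limf_einf
    (fun h : R => dist_set A (u + h *: v)%R * (h^-1)%:E) (0%R : R)^'+ = 0].

(* the norm of the library on Z * Y is the maximum of the two norms *)
Definition contingent_derivative {Z Y : normedModType R} (H : Z -> set Y)
    (z0 : Z) (y0 : Y) : Z -> set Y :=
  fun z => [set y | contingent_cone (sv_graph H) (z0, y0) (z, y)].

End ContingentCone.

Section ParametricProblem.
Context {R : realType} {X Y Z : normedModType R}.
Variables (Yp : set Y) (Zp : set Z).
Variables (Omega : set X) (F : X -> set Y) (G : X -> set Z).

Definition feasible (z : Z) : set X :=
  [set x | Omega x /\ G x `&` shift_opp z Zp !=set0].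

Definition value_map (z : Z) : set Y := sv_image F (feasible z).

Definition value_map_plus (z : Z) : set Y := minkowski_sum (value_map z) Yp.

Definition minimal_point (y0 : Y) : Prop := Min Yp (value_map 0) y0.

(* Elements of Z^* x Y^*: pairs of continuous linear functionals. *)
Definition multipliers (y0 : Y) : set ({linear Z -> R^o} * {linear Y -> R^o}) :=
  [set m : {linear Z -> R^o} * {linear Y -> R^o} |
    [/\ continuous m.1, continuous m.2,
    forall (z' : Z) (y' : Y), set_opp Zp z' -> shift_opp y0 Yp y' ->
      (m.1 z' + m.2 y' <= m.2 y0 :> R) &
    forall (z : Z) (y : Y), sv_graph value_map_plus (z, y) ->
      (m.2 y0 <= m.1 z + m.2 y :> R)]].

Definition lagrange_process (y0 : Y) (z : Z) : set Y :=
  [set y | forall m, multipliers y0 m -> (m.1 z <= m.2 y :> R)].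

End ParametricProblem.

Definition cone_convex_map {R : realType} {X Y : normedModType R}
    (K : set Y) (Omega : set X) (H : X -> set Y) : Prop :=
  convex_set [set p : X * Y | Omega p.1 /\ minkowski_sum (H p.1) K p.2].

(* Main.v *)
Require Import Defs.
From HB Require Import structures.
From mathcomp Require Import all_boot all_order all_algebra.
From mathcomp Require Import all_classical all_reals all_analysis.
From mathcomp Require Import ring lra.
Import Order.TTheory GRing.Theory Num.Theory.
Import numFieldNormedType.Exports.
Local Open Scope classical_set_scope.
Local Open Scope ring_scope.

(** Write C for the graph of V + Y_+ and u for the point (0, y0) of C.  Both
    sides of the equality describe the closed convex cone spanned by C - u, one
    by its supporting half-spaces and the other by its tangent directions.

    The set C is convex, because (z, y) lies in C exactly when some x in Omega
    has z in G(x) + Z_+ and y in F(x) + Y_+ (value_graphE), so that C is the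
    projection of the intersection of two convex sets.  It also absorbs
    Z_+ x Y_+ (value_graphD).

    On the Lagrange side, the condition of a multiplier (a, b) on
    (-Z_+) x (y0 - Y_+) says that a and b are nonnegative on Z_+ and Y_+.
    Since u + Z_+ x Y_+ lies in C, this follows from the condition on C, and the
    multipliers are exactly the elements of the positive polar of the cone
    generated by C - u (multipliersE, pair_dual, dual_pair).  Hence the graph of
    z |-> L(-z) is the bipolar of that cone, which is its closure
    (cone_bipolar).

    On the contingent side, the segment from u to a point of C stays in C, so a
    direction that is approached by one ray of C - u is approached at all small
    scales.  The lower limit in the contingent cone is then 0 exactly on the
    closure of the cone generated by C - u (contingent_cone_convex).

    The bipolar theorem rests on Hahn-Banach in the form: every sublinear
    functional has a linear minorant (sublinear_minorant).  Zorn's lemma gives a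
    minimal sublinear functional below the given one, and minimality forces
    linearity.  Working with functionals defined on the whole space avoids
    extending partial linear maps.  The auxiliary sublinear functionals all
    arise as infima (sublinear_inf). *)

(** * Sublinear functionals and the Hahn-Banach theorem *)

Section SublinearFunctionals.
Context {R : realType} {V : lmodType R}.
Implicit Types (p q : V -> R) (x y : V).

Definition sublinear p :=
  (forall x y, p (x + y) <= p x + p y) /\
  (forall (t : R) x, 0 < t -> p (t *: x) <= t * p x).

Lemma sublinear0 {p} : sublinear p -> p 0 = 0.
Proof.
move=> [pD pZ]; have := pD 0 0; rewrite addr0 => p00.
have := pZ 2^-1 0; rewrite scaler0 => /(_ ltac:(lra)) p0h.
by apply/eqP; rewrite eq_le; apply/andP; split; lra.
Qed.

Lemma sublinearZ {p} {t : R} {x} :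
  sublinear p -> 0 <= t -> p (t *: x) = t * p x.
Proof.
move=> sp; rewrite le_eqVlt => /predU1P[<-|t0].
  by rewrite scale0r mul0r sublinear0.
have [_ pZ] := sp; apply/eqP; rewrite eq_le pZ//=.
rewrite -ler_pdivlMl//; have := pZ t^-1 (t *: x).
by rewrite scalerA mulVf ?gt_eqF// scale1r invr_gt0; apply.
Qed.

Lemma sublinear_lbN {p} x y : sublinear p -> p y - p (- x) <= p (x + y).
Proof.
by move=> [pD _]; rewrite lerBlDr -{1}(addKr x y) [leRHS]addrC; exact: pD.
Qed.

(** When the pairs (x, r) with r in E x are closed under addition (up to
    lowering the second component) and under positive scaling, they behave as
    the epigraph of a sublinear functional, whose values are recovered as infima
    of the vertical sections. *)
Lemma sublinear_inf (E : V -> set R) :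
  (forall x, E x !=set0) -> (forall x, has_lbound (E x)) ->
  (forall x y r s, E x r -> E y s -> exists2 u, E (x + y) u & u <= r + s) ->
  (forall (t : R) x r, 0 < t -> E x r -> E (t *: x) (t * r)) ->
  sublinear (fun x => inf (E x)).
Proof.
move=> E0 Elb ED EZ; split=> [x y|t x t0].
  rewrite -lerBlDr; apply: lb_le_inf => // r Exr.
  rewrite lerBlDr -lerBlDl; apply: lb_le_inf => // s Eys.
  have [u Eu urs] := ED _ _ _ _ Exr Eys.
  by rewrite lerBlDl; apply: le_trans urs; exact: ge_inf.
rewrite -ler_pdivrMl//; apply: lb_le_inf => // r Exr.
by rewrite ler_pdivrMl//; apply: ge_inf => //; exact: EZ.
Qed.

(** For fixed y, the functional x |-> inf over t >= 0 of q (x + t y) - t q y is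
    sublinear and at most q.  By minimality it is equal to q, and its term at
    t = 1 gives q x + q y <= q (x + y). *)
Lemma minimal_sublinear_linear q : sublinear q ->
  (forall q', sublinear q' -> (forall x, q' x <= q x) ->
    forall x, q x <= q' x) ->
  linear (q : V -> R^o).
Proof.
move=> sq qmin.
have qD x y : q (x + y) = q x + q y.
  apply/eqP; rewrite eq_le sq.1/= -lerBrDr.
  pose E x := [set q (x + t *: y) - t * q y | t in [set t : R | 0 <= t]].
  have Elb z : lbound (E z) (- q (- z)).
    move=> _ [t /= t0 <-].
    by rewrite -(sublinearZ sq)// lerBrDr addrC; exact: sublinear_lbN.
  have sE : sublinear (fun x => inf (E x)).
    apply: sublinear_inf.
    - by move=> z; exists (q z), 0 => //=; rewrite scale0r mul0r addr0 subr0.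
    - by move=> z; exists (- q (- z)); exact: Elb.
    - move=> z w _ _ [t /= t0 <-] [s /= s0 <-].
      exists (q (z + w + (t + s) *: y) - (t + s) * q y).
        by exists (t + s) => //=; exact: addr_ge0.
      by rewrite scalerDl addrACA; have := sq.1 (z + t *: y) (w + s *: y); lra.
    - move=> t z _ t0 [s /= s0 <-]; exists (t * s).
        exact: mulr_ge0 (ltW t0) s0.
      by rewrite -scalerA -scalerDr (sublinearZ sq) ?(ltW t0)// mulrBr mulrA.
  have Eq z : inf (E z) <= q z.
    apply: ge_inf; first by exists (- q (- z)); exact: Elb.
    by exists 0 => //=; rewrite scale0r mul0r addr0 subr0.
  apply: (le_trans (qmin _ sE Eq x)).
  apply: ge_inf; first by exists (- q (- x)); exact: Elb.
  by exists 1; rewrite /= ?scale1r ?mul1r.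
have qN x : q (- x) = - q x.
  by apply/eqP; rewrite -addr_eq0 -qD addNr sublinear0.
move=> t x y; rewrite qD; congr (_ + _).
have [t0|t0] := leP 0 t; first exact: sublinearZ.
rewrite -[t in LHS]opprK scaleNr qN sublinearZ ?oppr_ge0 1?ltW//.
by rewrite mulNr opprK.
Qed.

(** The pointwise infimum of a chain stays finite because every member q
    satisfies q x >= - q (- x) >= - p (- x). *)
Lemma chain_lower_bound {A : set (V -> R)} {p} :
  A !=set0 -> (forall q, A q -> sublinear q /\ forall x, q x <= p x) ->
  (forall q1 q2, A q1 -> A q2 ->
    (forall x, q1 x <= q2 x) \/ (forall x, q2 x <= q1 x)) ->
  exists q0, [/\ sublinear q0, forall x, q0 x <= p x &
    forall q, A q -> forall x, q0 x <= q x].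
Proof.
move=> [q1 Aq1] Asub Achain.
pose E x := [set q x | q in A].
have Elb x : has_lbound (E x).
  exists (- p (- x)) => _ [q Aq <-]; have [sq qp] := Asub _ Aq.
  have := sublinear_lbN x 0 sq; rewrite addr0 (sublinear0 sq) sub0r.
  by apply: le_trans; rewrite lerN2.
have inf_le q x : A q -> inf (E x) <= q x.
  by move=> Aq; apply: ge_inf => //; exists q.
exists (fun x => inf (E x)); split; last by move=> q Aq x; exact: inf_le.
- apply: sublinear_inf => //.
  + by move=> x; exists (q1 x), q1.
  + move=> x y _ _ [qx Aqx <-] [qy Aqy <-].
    case: (Achain _ _ Aqx Aqy) => [xy|yx].
    * exists (qx (x + y)); first by exists qx.
      by apply: le_trans ((Asub _ Aqx).1.1 _ _) _; rewrite lerD2l.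
    * exists (qy (x + y)); first by exists qy.
      by apply: le_trans ((Asub _ Aqy).1.1 _ _) _; rewrite lerD2r.
  + move=> t x _ t0 [q Aq <-]; exists q => //.
    by rewrite (sublinearZ (Asub _ Aq).1)// ltW.
- by move=> x; apply: le_trans (inf_le _ _ Aq1) _; exact: (Asub _ Aq1).2.
Qed.

(** Hahn-Banach theorem, as the linearity of a minimal sublinear functional. *)
Lemma sublinear_minorant p : sublinear p ->
  exists f : {linear V -> R^o}, forall x, f x <= p x :> R.
Proof.
move=> sp.
pose T := {q : V -> R | sublinear q /\ forall x, q x <= p x}.
pose above (s t : T) := `[< forall x, sval t x <= sval s x >].
have [||A Atot|t tmin] :=
    @ZL_preorder T (exist _ p (conj sp (fun=> lexx _))) above.
- by move=> t; apply/asboolP => x.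
- move=> r s t /asboolP rs /asboolP st; apply/asboolP => x.
  exact: le_trans (st x) (rs x).
- have [->|/set0P[t At]] := eqVneq A set0.
    by exists (exist _ p (conj sp (fun=> lexx _))).
  have [|q /= [u Au <-]|q1 q2 [u1 Au1 <-] [u2 Au2 <-]|q0 [sq0 q0p q0min]] :=
      @chain_lower_bound [set sval u | u in A] p.
  + by exists (sval t), t.
  + exact: (svalP u).
  + by case: (Atot _ _ Au1 Au2) => /asboolP; [right|left].
  + exists (exist _ q0 (conj sq0 q0p)) => s As; apply/asboolP => x /=.
    by apply: q0min; exists s.
- have [sq qp] := svalP t.
  have lq : linear (sval t : V -> R^o).
    apply: minimal_sublinear_linear => // q' sq' q'q.
    have q'p x : q' x <= p x by exact: le_trans (q'q x) (qp x).
    have /tmin/asboolP// : above t (exist _ q' (conj sq' q'p)).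
    by apply/asboolP.
  pose f := GRing.isLinear.Build R V R^o *:%R (sval t) lq.
  pose g : {linear V -> R^o} := HB.pack (sval t) f.
  by exists g.
Qed.

End SublinearFunctionals.

(** * Bipolar theorem for convex cones *)

Section Bipolar.
Context {R : realType} {V : normedModType R}.
Implicit Types (K : set V) (f : {linear V -> R^o}).

Lemma contractive_continuous f : (forall x, f x <= `|x| :> R) -> continuous f.
Proof.
move=> fle; apply: bounded_linear_continuous; apply/ex_bound; exists 1.
apply/nbhs_norm0P; exists 1 => //= x /= x1.
apply: le_trans (ltW x1); rewrite ler_norml fle andbT lerNl -linearN -normrN.
exact: fle.
Qed.

Lemma closure_normP K (x : V) :
  closure K x <-> forall e : R, 0 < e -> exists2 k, K k & `|x - k| < e.
Proof.
split=> [Kx e e0|Kx B /nbhs_normP[e /= e0 eB]].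
  have [k [Kk /= xk]] := Kx _ (nbhsx_ballx x e e0).
  by exists k => //; move: xk; rewrite -ball_normE.
by have [k Kk xk] := Kx e e0; exists k; split => //; exact: eB.
Qed.

(** If v is at distance at least e from K, then
    x |-> inf of |x + k - s v| - s e over k in K and s >= 0 is a sublinear
    functional.  It is finite because |k - s v| >= s e.  A linear minorant f is
    contractive (k = 0, s = 0), nonnegative on K (x = - k, s = 0) and satisfies
    f v <= - e (k = 0, s = 1), so f separates v from K. *)
Lemma cone_bipolar K (v : V) :
  K 0 -> (forall x y, K x -> K y -> K (x + y)) ->
  (forall (t : R) x, 0 < t -> K x -> K (t *: x)) ->
  closure K v <-> forall f, continuous f -> (forall k, K k -> 0 <= f k :> R) ->
    0 <= f v :> R.
Proof.
move=> K0 KD KZ; split=> [/closure_normP Kv f fcont fK|fv].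
  rewrite leNgt; apply/negP => fv0.
  have /cvgrPdist_lt/(_ (- f v)) := fcont v; rewrite oppr_gt0 => /(_ fv0).
  move=> /nbhs_normP[e /= e0 eB].
  have [k Kk /eB/= ] := Kv _ e0.
  rewrite ltr_norml => /andP[fvk _]; have := fK _ Kk; lra.
apply/closure_normP => e e0; apply: contrapT => Kve.
have vK k : K k -> e <= `|v - k|.
  by move=> Kk; rewrite leNgt; apply/negP => vk; apply: Kve; exists k.
pose E x := [set `|x + k.1 - k.2 *: v| - k.2 * e |
  k in [set k : V * R | K k.1 /\ 0 <= k.2]].
have Elb x : lbound (E x) (- `|x|).
  move=> _ [[k s] /= [Kk s0] <-].
  have ske : s * e <= `|k - s *: v|.
    move: s0; rewrite le_eqVlt => /predU1P[<-|s0]; first by rewrite mul0r.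
    rewrite -ler_pdivlMl// -[s^-1]gtr0_norm ?invr_gt0// -normrZ scalerBr.
    rewrite scalerA mulVf ?gt_eqF// scale1r distrC; apply: vK.
    by apply: KZ => //; rewrite invr_gt0.
  have := ler_normB (x + (k - s *: v)) x; rewrite addrC addKr addrA => h.
  lra.
have Ehas x : has_lbound (E x) by exists (- `|x|); exact: Elb.
have [|f fE] := @sublinear_minorant R V (fun x => inf (E x)).
  apply: sublinear_inf => //.
  - move=> x; exists `|x + 0 - 0 *: v|; exists (0, 0) => //=.
    by rewrite mul0r subr0.
  - move=> x y _ _ [[k s] /= [Kk s0] <-] [[l t] /= [Kl t0] <-].
    exists (`|(x + y) + (k + l) - (s + t) *: v| - (s + t) * e).
      by exists (k + l, s + t) => //=; split; [exact: KD|exact: addr_ge0].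
    rewrite (addrACA x y) scalerDl opprD (addrACA (x + k)).
    have := ler_normD (x + k - s *: v) (y + l - t *: v); lra.
  - move=> t x _ t0 [[k s] /= [Kk s0] <-]; exists (t *: k, t * s).
      by split => /=; [exact: KZ|exact: mulr_ge0 (ltW t0) s0].
    by rewrite /= mulrBr -scalerA -scalerDr -scalerBr normrZ gtr0_norm// mulrA.
have fK k s x : K k -> 0 <= s -> f x <= `|x + k - s *: v| - s * e :> R.
  move=> Kk s0; apply: le_trans (fE x) _.
  by apply: ge_inf => //; exists (k, s).
suff : 0 <= f v :> R.
  have := fK 0 1 v K0 ler01; rewrite addr0 scale1r subrr normr0; lra.
apply: fv => [|k Kk].
  apply: contractive_continuous => x.
  by have := fK 0 0 x K0 (lexx _); rewrite addr0 scale0r mul0r !subr0.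
have := fK k 0 (- k) Kk (lexx _).
rewrite addNr scale0r mul0r !subr0 normr0 linearN; lra.
Qed.

End Bipolar.

(** * Contingent cones of convex sets *)

Section ConvexSets.
Context {R : realType} {V : lmodType R}.
Implicit Types A K : set V.

Lemma convex_setE A : convex_set A <->
  forall (t : R) x y, 0 <= t -> t <= 1 -> A x -> A y ->
    A (t *: x + (1 - t) *: y).
Proof.
split=> [cA t x y t0 t1 Ax Ay|cA x y t xA yA].
  by have := cA x y (Itv01 t0 t1); rewrite !inE; apply.
apply/mem_set.
exact: cA (ge0 t) (le1 t) (set_mem xA) (set_mem yA).
Qed.

End ConvexSets.

Section ContingentCone.
Context {R : realType} {V : normedModType R}.
Implicit Types (C K : set V) (u v : V).

Lemma convex_coneD K x y : convex_cone K -> K x -> K y -> K (x + y).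
Proof.
move=> [[_ KZ] /convex_setE cK] Kx Ky.
have -> : x + y = 2 *: (2^-1 *: x + (1 - 2^-1) *: y).
  rewrite scalerDr !scalerA mulrBr mulr1 divff ?pnatr_eq0// scale1r.
  by rewrite -[2 - 1]addrA subrr addr0 scale1r.
by apply: KZ => //; apply: cK => //; lra.
Qed.

Definition radial_cone C u : set V :=
  [set t *: (c - u) | c in C & t in [set t : R | 0 < t]].

Lemma radial_cone0 C u : C u -> radial_cone C u 0.
Proof.
by move=> Cu; exists u => //; exists 1 => //=; rewrite subrr scaler0.
Qed.

Lemma radial_coneZ C u (t : R) v :
  0 < t -> radial_cone C u v -> radial_cone C u (t *: v).
Proof.
move=> t0 [c Cc [s s0 <-]]; exists c => //; exists (t * s) => /=.
  exact: mulr_gt0.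
by rewrite scalerA.
Qed.

Lemma radial_coneD C u v w : convex_set C ->
  radial_cone C u v -> radial_cone C u w -> radial_cone C u (v + w).
Proof.
move=> /convex_setE cC [c Cc [s /= s0 <-]] [d Cd [t /= t0 <-]].
have st0 : 0 < s + t by exact: addr_gt0.
have st1 : 1 - s / (s + t) = t / (s + t) by field; rewrite gt_eqF.
exists ((s / (s + t)) *: c + (1 - s / (s + t)) *: d).
  apply: cC => //; first by rewrite ltW// divr_gt0.
  by rewrite ler_pdivrMr// mul1r lerDl ltW.
exists (s + t) => //=; rewrite st1 scalerBr scalerDr !scalerA.
rewrite ![(s + t) * _]mulrC !divfK ?gt_eqF// scalerDl.
by rewrite opprD addrACA -!scalerBr.
Qed.

Lemma dist_set_ge0 C u : (0 <= dist_set C u)%E.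
Proof. by apply: le_ereal_inf_tmp => _ [c Cc <-]; rewrite lee_fin. Qed.

(** A scale h at which the distance from u + h v to C is less than e h gives the
    vector (c - u) / h within e of v.  Conversely, if t (c - u) is within e of
    v, convexity puts u + h t (c - u) in C for every h <= 1 / t, and this point
    is within e h of u + h v. *)
Lemma contingent_cone_convex C u : convex_set C -> C u ->
  contingent_cone C u = closure (radial_cone C u).
Proof.
move=> cC Cu; apply/seteqP; split=> v; rewrite /contingent_cone/= limf_einfE.
  move=> Cv; apply/closure_normP => e e0.
  have : (ereal_inf [set (dist_set C (u + h *: v)%R * (h^-1)%:E)%E |
      h in [set h : R | (0 < h)%R]] < e%:E)%E.
    apply: (@le_lt_trans _ _ 0%E); last by rewrite lte_fin.
    rewrite -Cv; apply: ereal_sup_ubound.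
    by exists [set h : R | 0 < h] => //; exact: nbhs_right_gt.
  move=> /ereal_inf_lt[_ [h /= h0 <-]]; rewrite lte_pdivrMr//.
  move=> /ereal_inf_lt[_ [c Cc <-]]; rewrite lte_fin => ch.
  exists (h^-1 *: (c - u)).
    by exists c => //; exists h^-1 => //=; rewrite invr_gt0.
  have -> : v - h^-1 *: (c - u) = h^-1 *: (u + h *: v - c).
    rewrite -{1}[v](scalerK (lt0r_neq0 h0)) -scalerBr; congr (_ *: _).
    by rewrite opprB addrCA addrA.
  by rewrite normrZ gtr0_norm ?invr_gt0// mulrC ltr_pdivrMr.
move=> /closure_normP Cv; apply/eqP; rewrite eq_le; apply/andP; split.
  apply: ge_ereal_sup => _ [B B0 <-].
  apply/lee_addgt0Pr => e e0; rewrite add0e.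
  have [_ [c Cc [t /= t0 <-]] vt] := Cv _ e0.
  (* the bound h <= 1 / t makes h * t a legitimate convex coefficient *)
  have [h [Bh h0 ht]] : exists h : R, [/\ B h, 0 < h & h <= t^-1].
    have /filter_ex[h [[Bh h0] ht]] : \forall h \near (0 : R)^'+,
        (B h /\ 0 < h) /\ h <= t^-1.
      apply: filterI; first by apply: filterI => //; exact: nbhs_right_gt.
      by apply: nbhs_right_ltW; rewrite invr_gt0.
    by exists h.
  apply: ge_ereal_inf; exists (dist_set C (u + h *: v)%R * (h^-1)%:E)%E.
    by exists h.
  rewrite lee_pdivrMr//; apply: ge_ereal_inf.
  have ht1 : h * t <= 1 by rewrite -ler_pdivlMr// mul1r.
  exists (`|u + h *: v - ((h * t) *: c + (1 - h * t) *: u)|%:E).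
    exists ((h * t) *: c + (1 - h * t) *: u) => //.
    by apply: (convex_setE _).1 => //; exact: mulr_ge0 (ltW h0) (ltW t0).
  rewrite -EFinM lee_fin [e * h]mulrC.
  have -> : u + h *: v - ((h * t) *: c + (1 - h * t) *: u) =
      h *: (v - t *: (c - u)).
    rewrite scalerBr scalerA scalerBl scale1r scalerBr.
    by rewrite [_ *: c + _]addrCA [u + _]addrC addrKA.
  by rewrite normrZ gtr0_norm// ler_pM2l// ltW.
apply: le_ereal_sup_tmp.
exists (ereal_inf [set (dist_set C (u + h *: v)%R * (h^-1)%:E)%E |
      h in [set h : R | (0 < h)%R]]).
  by exists [set h : R | 0 < h] => //; exact: nbhs_right_gt.
apply: le_ereal_inf_tmp => _ [h /= h0 <-].
by rewrite mule_ge0 ?dist_set_ge0// lee_fin invr_ge0 ltW.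
Qed.

End ContingentCone.

(** * The graph of the value map *)

Section ValueGraph.
Context {R : realType} {X Y Z : normedModType R}.
Context {Yp : set Y} {Zp : set Z} {Omega : set X}.
Context {F : X -> set Y} {G : X -> set Z}.

Local Notation C := (sv_graph (value_map_plus Yp Zp Omega F G)).

(** The shifts by Y_+ and Z_+ become symmetric in this form, and x is
    existentially quantified, so convexity of C is inherited by projection from
    the convexity of F and of G. *)
Lemma value_graphE z y : C (z, y) <->
  exists x, [/\ Omega x, minkowski_sum (F x) Yp y & minkowski_sum (G x) Zp z].
Proof.
split=> [[a [x [Ox [w [Gw [c Zc /= cw]]]] Fa] [b Yb <-]]|].
  exists x; split=> //; first by exists a => //; exists b.
  by exists w => //; exists c => //; rewrite -cw subrK.
move=> [x [Ox [a Fa [b Yb <-]] [w Gw [c Zc <-]]]].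
exists a; last by exists b.
exists x => //; split => //; exists w; split => //.
by exists c => //; rewrite addrK.
Qed.

Lemma minkowski_sumDr {V : normedModType R} (A K : set V) v k :
  convex_cone K -> minkowski_sum A K v -> K k -> minkowski_sum A K (v + k).
Proof.
move=> cK [a Aa [b Kb <-]] Kk; exists a => //; exists (b + k).
  exact: convex_coneD.
by rewrite addrA.
Qed.

Lemma value_graphD z y z' y' : convex_cone Yp -> convex_cone Zp ->
  C (z, y) -> Zp z' -> Yp y' -> C (z + z', y + y').
Proof.
move=> cY cZ /value_graphE[x [Ox Fy Gz]] Zz Yy; apply/value_graphE.
by exists x; split => //; exact: minkowski_sumDr.
Qed.

Lemma value_graph_convex :
  convex_set Omega -> cone_convex_map Yp Omega F ->
  cone_convex_map Zp Omega G -> convex_set C.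
Proof.
move=> /convex_setE cO /convex_setE cF /convex_setE cG; apply/convex_setE.
move=> t [z1 y1] [z2 y2] t0 t1.
move=> /value_graphE[x1 [Ox1 Fy1 Gz1]] /value_graphE[x2 [Ox2 Fy2 Gz2]].
apply/value_graphE; exists (t *: x1 + (1 - t) *: x2); split.
- exact: cO.
- by have [] := cF t (x1, y1) (x2, y2) t0 t1 (conj Ox1 Fy1) (conj Ox2 Fy2).
- by have [] := cG t (x1, z1) (x2, z2) t0 t1 (conj Ox1 Gz1) (conj Ox2 Gz2).
Qed.

Lemma value_graph_base y0 : convex_cone Yp ->
  minimal_point Yp Zp Omega F G y0 -> C (0, y0).
Proof.
move=> [[[k Yk] YZ] _] [Vy0 _]; exists y0 => //; exists 0; last exact: addr0.
by rewrite -(scale0r k); exact: YZ.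
Qed.

End ValueGraph.

(** * Lagrange multipliers as polar elements *)

Section ProductDual.
Context {R : realType} {Z Y : normedModType R}.

Lemma pair_dual (f : {linear (Z * Y)%type -> R^o}) : continuous f ->
  exists m : {linear Z -> R^o} * {linear Y -> R^o},
    [/\ continuous m.1, continuous m.2 & forall z y, f (z, y) = m.1 z + m.2 y].
Proof.
move=> fcont.
pose f1 z := f (z, 0 : Y); pose f2 y := f (0 : Z, y).
have l1 : linear (f1 : Z -> R^o).
  move=> t a b; rewrite /f1 -linearP; congr (f _).
  by congr pair; rewrite /= scaler0 addr0.
have l2 : linear (f2 : Y -> R^o).
  move=> t a b; rewrite /f2 -linearP; congr (f _).
  by congr pair; rewrite /= scaler0 addr0.
pose g1 : {linear Z -> R^o} :=
  HB.pack f1 (GRing.isLinear.Build R Z R^o *:%R f1 l1).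
pose g2 : {linear Y -> R^o} :=
  HB.pack f2 (GRing.isLinear.Build R Y R^o *:%R f2 l2).
exists (g1, g2); split=> [a|b|z y].
- apply: (@continuous_comp _ _ _ (fun z : Z => (z, 0 : Y)) f).
    by apply: cvg_pair; [exact: cvg_id|exact: cvg_cst].
  exact: fcont.
- apply: (@continuous_comp _ _ _ (fun y : Y => (0 : Z, y)) f).
    by apply: cvg_pair; [exact: cvg_cst|exact: cvg_id].
  exact: fcont.
- rewrite /= /f1 /f2 -linearD; congr (f _).
  by congr pair; rewrite /= ?addr0 ?add0r.
Qed.

Lemma dual_pair (m : {linear Z -> R^o} * {linear Y -> R^o}) :
  continuous m.1 -> continuous m.2 ->
  exists f : {linear (Z * Y)%type -> R^o},
    continuous f /\ forall z y, f (z, y) = m.1 z + m.2 y.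
Proof.
move=> c1 c2; pose f (p : Z * Y) : R^o := m.1 p.1 + m.2 p.2.
have lf : linear f.
  by move=> t a b; rewrite /f !linearP scalerDr addrACA.
pose g : {linear (Z * Y)%type -> R^o} :=
  HB.pack f (GRing.isLinear.Build R (Z * Y)%type R^o *:%R f lf).
exists g; split=> // p; apply: cvgD.
- by apply: (@continuous_comp _ _ _ fst m.1); [exact: cvg_fst|exact: c1].
- by apply: (@continuous_comp _ _ _ snd m.2); [exact: cvg_snd|exact: c2].
Qed.

End ProductDual.

Section Multipliers.
Context {R : realType} {X Y Z : normedModType R}.
Context {Yp : set Y} {Zp : set Z} {Omega : set X}.
Context {F : X -> set Y} {G : X -> set Z}.

Local Notation C := (sv_graph (value_map_plus Yp Zp Omega F G)).

(** The two inequalities required of a multiplier reduce to nonnegativity on the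
    cone generated by C - (0, y0), because that cone contains Z_+ x Y_+. *)
Lemma multipliersE y0 (m : {linear Z -> R^o} * {linear Y -> R^o}) :
  convex_cone Yp -> convex_cone Zp -> C (0, y0) ->
  multipliers Yp Zp Omega F G y0 m <->
  [/\ continuous m.1, continuous m.2 & forall z y,
    radial_cone C (0, y0) (z, y) -> 0 <= m.1 z + m.2 y :> R].
Proof.
move=> cY cZ C0; split=> [[m1 m2 _ mC]|[m1 m2 mC]]; split=> //.
- move=> _ _ [[z y] Czy [t /= t0 [<- <-]]].
  rewrite subr0 !linearZ/= -mulrDr; apply: mulr_ge0; first exact: ltW.
  by rewrite linearB/= addrA subr_ge0; exact: mC.
- move=> _ _ [z' Zz' <-] [y' Yy' <-].
  rewrite linearN linearB/=.
  have /mC : radial_cone C (0, y0) (z', y').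
    exists (0 + z', y0 + y'); first exact: value_graphD.
    exists 1 => //=; rewrite scale1r.
    by congr (_, _); rewrite addrAC subrr add0r.
  lra.
- move=> z y Czy; have /mC : radial_cone C (0, y0) (z, y - y0).
    exists (z, y) => //; exists 1 => //=.
    by rewrite scale1r; congr (_, _); rewrite subr0.
  by rewrite linearB/= addrA subr_ge0.
Qed.

End Multipliers.

(** * The Lagrange process and the contingent derivative *)

Theorem theorem5p5 (R : realType) (X Y Z : normedModType R)
    (Yp : set Y) (Zp : set Z) (Omega : set X)
    (F : X -> set Y) (G : X -> set Z)
    (Yp_cone : convex_cone Yp) (Yp_proper : proper_cone Yp)
    (Yp_solid : solid Yp) (Yp_pointed : pointed Yp)
    (Zp_cone : convex_cone Zp) (Zp_proper : proper_cone Zp)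
    (Zp_solid : solid Zp)
    (Omega_neq0 : Omega !=set0) (Omega_convex : convex_set Omega)
    (F_convex : cone_convex_map Yp Omega F)
    (G_convex : cone_convex_map Zp Omega G)
    (feasible_dom : forall z : Z, feasible Zp Omega G z `<=` sv_dom F)
    (y0 : Y) (y0_min : minimal_point Yp Zp Omega F G y0)
    (slater : exists2 x1 : X, Omega x1 & G x1 `&` set_opp Zp° !=set0) :
  forall z : Z,
    lagrange_process Yp Zp Omega F G y0 (- z) =
    contingent_derivative (value_map_plus Yp Zp Omega F G) 0 y0 z.
Proof.
move=> z; rewrite /contingent_derivative.
have C0 := value_graph_base y0 Yp_cone y0_min.
have cC := value_graph_convex Omega_convex F_convex G_convex.
rewrite (contingent_cone_convex _ _ cC C0).
have bipolar v := cone_bipolar _ v (radial_cone0 _ _ C0)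
  (fun a b => radial_coneD _ _ a b cC) (fun t a => radial_coneZ _ _ t a).
apply/seteqP; split=> y /=.
- move=> Ly; apply/bipolar => f /pair_dual[m [m1 m2 fm]] fC.
  have := Ly m; rewrite fm linearN/= lerNl -subr_ge0 opprK; apply.
  apply/multipliersE => //; split=> // a b; rewrite -fm; exact: fC.
- move=> /bipolar Cy m /multipliersE[]// m1 m2 mC.
  have [f [fcont fm]] := dual_pair _ m1 m2.
  rewrite linearN/= lerNl -subr_ge0 opprK -fm; apply: Cy => // -[a b].
  by rewrite fm; exact: mC.
Qed.
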